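(* For every integer $m \geq 3$, let $\Delta_{2m-1}$ be the simplicial polytope dual (polar) to the $2 \times 2m$ transportation polytope $P(\mathbf{a},\mathbf{b})$ with margins $\mathbf{a} = (2m-1,2m+1) \in \mathbb{R}^2$ and $\mathbf{b} = (2,2,\ldots,2) \in \mathbb{R}^{2m}$. Then $\Delta_{2m-1}$ is not weakly vertex-decomposable.
   Context: Simplicial complexes. A simplicial complex $\Delta$ on a (finite) vertex set $V$ is a collection of subsets of $V$, called faces, such that if $F \in \Delta$ and $G \subseteq F$ then $G \in \Delta$. The dimension of a face $F$ is $|F|-1$, and $\dim(\Delta)$ is the maximum dimension of a face of $\Delta$. A facet of $\Delta$ is a face that is maximal under inclusion, and $\Delta$ is pure if all its facets have the same dimension. For a face $\tau \in \Delta$, the antistar (deletion) is $\Delta - \tau = \{G \in \Delta : \tau \nsubseteq G\}$. Weak $k$-decomposability. Let $\Delta$ be a $(d-1)$-dimensional simplicial complex and let $0 \leq k \leq d-1$. Recursively, $\Delta$ is weakly $k$-decomposable if $\Delta$ is pure and either (1) $\Delta$ is a $(d-1)$-simplex (i.e. the complex of all subsets of a $d$-element set), or (2) there exists a face $\tau \in \Delta$ with $\dim(\tau) \leq k$ such that $\Delta - \tau$ is $(d-1)$-dimensional and weakly $k$-decomposable. Weakly vertex-decomposable means weakly $0$-decomposable. Transportation polytopes. For $\mathbf{a} = (a_1,\ldots,a_p) \in \mathbb{R}^p$ and $\mathbf{b} = (b_1,\ldots,b_n) \in \mathbb{R}^n$ (the margins), the $p \times n$ transportation polytope $P(\mathbf{a},\mathbf{b})$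 is the set of all real $p \times n$ matrices $X = (x_{i,j})$ with nonnegative entries such that $\sum_{i=1}^p x_{i,j} = b_j$ for all $1 \leq j \leq n$ and $\sum_{j=1}^n x_{i,j} = a_i$ for all $1 \leq i \leq p$. Polar. The polar (dual) of a simple polytope $P$ is taken within its affine hull and is a simplicial polytope; a simplicial polytope is identified with its boundary complex when speaking of weak vertex-decomposability. Combinatorially, the boundary complex of the polar of a simple polytope $P$ is the simplicial complex whose vertices are the facets of $P$ and whose faces are the sets of facets of $P$ that have a common point (the empty set being a face); its facets correspond to the vertices of $P$. *)

(* Defs.v *)
From HB Require Import structures.
From mathcomp Require Import all_boot all_order all_algebra.
From mathcomp Require Import finmap.
From mathcomp Require Import boolp classical_sets reals.

Set Implicit Arguments.
Unset Strict Implicit.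
Unset Printing Implicit Defensive.

Import Order.TTheory GRing.Theory Num.Theory.
Local Open Scope classical_set_scope.
Local Open Scope ring_scope.

Record complex (T : choiceType) := Complex {
  faces : set {fset T};
  faces_sub : forall F G : {fset T}, faces F -> (G `<=` F)%fset -> faces G }.

(* Only dimensions >= 0 are considered; a face F has dimension #|` F| - 1. *)
Definition has_dim (T : choiceType) (D : complex T) (r : nat) : Prop :=
  (exists2 F, faces D F & #|` F| = r.+1) /\
  (forall F, faces D F -> (#|` F| <= r.+1)%N).

Definition complex_facet (T : choiceType) (D : complex T) (F : {fset T}) : Prop :=
  faces D F /\ forall G, faces D G -> (F `<=` G)%fset -> G = F.

Definition pure (T : choiceType) (D : complex T) : Prop :=
  forall F G, complex_facet D F -> complex_facet D G -> #|` F| = #|` G|.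

Definition is_simplex (T : choiceType) (D : complex T) (r : nat) : Prop :=
  exists2 W : {fset T}, #|` W| = r.+1 &
    forall F : {fset T}, faces D F <-> (F `<=` W)%fset.

Fact antistar_sub (T : choiceType) (D : complex T) (tau F G : {fset T}) :
  faces D F /\ ~~ (tau `<=` F)%fset -> (G `<=` F)%fset ->
  faces D G /\ ~~ (tau `<=` G)%fset.
Proof.
move=> [DF tauF] GF; split; first exact: faces_sub DF GF.
by apply: contra tauF => /fsubset_trans; apply.
Qed.

Definition antistar (T : choiceType) (D : complex T) (tau : {fset T}) : complex T :=
  @Complex T [set G | faces D G /\ ~~ (tau `<=` G)%fset] (@antistar_sub T D tau).

Inductive weakly_decomposable (T : choiceType) (k : nat) (D : complex T) : Prop :=
| WD_simplex (r : nat) of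
    has_dim D r & (k <= r)%N & pure D & is_simplex D r
| WD_shed (r : nat) (tau : {fset T}) of
    has_dim D r & (k <= r)%N & pure D &
    faces D tau & (#|` tau| <= k.+1)%N &
    has_dim (antistar D tau) r & weakly_decomposable k (antistar D tau).

Definition weakly_vertex_decomposable (T : choiceType) (D : complex T) : Prop :=
  weakly_decomposable 0 D.

Definition is_face (R : realType) (V : vectType R) (P F : set V) : Prop :=
  exists (c : {scalar V}) (delta : R),
    (forall x, P x -> c x <= delta) /\ F = [set x | P x /\ c x = delta].

(* x0 + U is the affine hull of A. *)
Definition has_affdim (R : realType) (V : vectType R) (A : set V) (r : nat) : Prop :=
  exists (x0 : V) (U : {vspace V}),
    [/\ A x0, forall x, A x -> x - x0 \in U,
        forall W : {vspace V}, (forall x, A x -> x - x0 \in W) -> (U <= W)%VS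
      & \dim U = r].

Definition is_facet (R : realType) (V : vectType R) (P F : set V) : Prop :=
  is_face P F /\ exists2 r, has_affdim P r.+1 & has_affdim F r.

Definition polar_faces (R : realType) (V : vectType R) (P : set V) :
    set {fset set V} :=
  [set S | (forall F, F \in S -> is_facet P F) /\
           exists2 x, P x & forall F, F \in S -> F x].

Fact polar_faces_sub (R : realType) (V : vectType R) (P : set V)
    (S S' : {fset set V}) :
  polar_faces P S -> (S' `<=` S)%fset -> polar_faces P S'.
Proof.
move=> [Sfacet [x Px Sx]] /fsubsetP S'S.
by split=> [F /S'S/Sfacet//|]; exists x => // F /S'S/Sx.
Qed.

(* Boundary complex of the polar of P, meaningful when P is a simple polytope
   of dimension at least 1. *)
Definition polar_complex (R : realType) (V : vectType R) (P : set V) :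
    complex (set V) :=
  Complex (@polar_faces_sub R V P).

Definition transportation (R : realType) (p n : nat)
    (a : 'rV[R]_p) (b : 'rV[R]_n) : set 'M[R]_(p, n) :=
  [set X | [/\ forall i j, 0 <= X i j,
               forall j, \sum_(i < p) X i j = b 0 j
             & forall i, \sum_(j < n) X i j = a 0 i]].

(* Main.v *)
(* In a 2 x n matrix of the polytope (n = p + q + 1, with p = m, q = m - 1) the
   columns are (x, 2 - x), so the facets are the loci where one entry vanishes.
   A face of the polar is therefore a pair (A, B) of disjoint sets of columns,
   with a zero in the first, resp. second, row, and the margins say exactly
   |A| <= p and |B| <= q.
   Shedding vertices shrinks the sets Z and U of columns allowed in A and B.
   If a set A of size p fits in Z :&: U while |U| < p + q, then (A, U :\: A) is
   a facet with fewer than p + q elements; so purity forces |U| >= p + q = n - 1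
   and, symmetrically, |Z| >= n - 1.  Shedding one more vertex still leaves
   |Z :&: U| >= n - 3 >= max(p, q), so by induction Z and U always meet; but a
   simplex needs Z and U disjoint. *)
Require Import Defs.
From HB Require Import structures.
From mathcomp Require Import all_boot all_order all_algebra.
From mathcomp Require Import finmap zify lra.
From mathcomp Require Import boolp classical_sets reals.

Import Order.TTheory GRing.Theory Num.Theory.
Local Open Scope ring_scope.

(** * Combinatorics of shedding: complexes of pairs of disjoint bounded sets *)

Section ShedVertices.
Set Implicit Arguments.
Unset Strict Implicit.
Import mathcomp.boot.fintype mathcomp.boot.finset.

(* [V A B] stands for the face of [D] with parts [A] and [B]. *)
Definition bipartite_complex {I : finType} {T : choiceType}
    (V : {set I} -> {set I} -> {fset T}) (p q : nat) (Z U : {set I})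
    (D : complex T) : Prop :=
  (forall A B, faces D (V A B) <->
     [/\ A \subset Z, B \subset U, [disjoint A & B],
         (#|A| <= p)%N & (#|B| <= q)%N]) /\
  (forall S, faces D S -> exists A B, S = V A B).

(** Shedding depends only on inclusion and size of faces, so this interface lets the argument run on
    pairs of column sets instead of sets of facets of a polytope. *)
Definition encodes_pairs {I : finType} {T : choiceType}
    (V : {set I} -> {set I} -> {fset T}) : Prop :=
  (forall A B A' B',
     (V A B `<=` V A' B')%fset = (A \subset A') && (B \subset B')) /\
  (forall A B, #|` V A B| = (#|A| + #|B|)%N).

Lemma encodes_pairs_swap (I : finType) (T : choiceType)
    (V : {set I} -> {set I} -> {fset T}) :
  encodes_pairs V -> encodes_pairs (fun A B => V B A).
Proof. by move=> [Vs Vc]; split=> *; rewrite (Vs, Vc) 1?(andbC, addnC). Qed.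

(** The symmetry between the two rows: results about [Z] and [p] carry over to [U] and [q]. *)
Lemma bipartite_complex_swap (I : finType) (T : choiceType)
    (V : {set I} -> {set I} -> {fset T}) (p q : nat) (Z U : {set I})
    (D : complex T) :
  bipartite_complex V p q Z U D ->
  bipartite_complex (fun A B => V B A) q p U Z D.
Proof.
move=> [fD DV]; split=> [A B|S /DV[A [B ->]]]; last by exists B, A.
by rewrite fD disjoint_sym; split=> -[].
Qed.

Lemma bipartite_face_card (I : finType) (T : choiceType)
    (V : {set I} -> {set I} -> {fset T}) (p q : nat) (Z U : {set I})
    (D : complex T) (S : {fset T}) :
  encodes_pairs V -> bipartite_complex V p q Z U D -> faces D S ->
  (#|` S| <= p + q)%N.
Proof.
move=> [_ Vc] [fD DV] DS; have [A [B defS]] := DV S DS; move: DS.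
by rewrite defS fD Vc => -[_ _ _ leA leB]; apply: leq_add.
Qed.

Lemma subset_of_card (I : finType) (X : {set I}) (k : nat) :
  (k <= #|X|)%N -> exists2 A : {set I}, A \subset X & #|A| = k.
Proof.
move=> kX; exists [set x in take k (enum X)].
  by apply/subsetP=> x; rewrite inE => /mem_take; rewrite mem_enum.
rewrite cardsE (card_uniqP _) ?size_take -?cardE;
  last exact/take_uniq/enum_uniq.
by case: ltngtP kX.
Qed.

Lemma bipartite_pure_card (I : finType) (T : choiceType)
    (V : {set I} -> {set I} -> {fset T}) (p q : nat) (Z U : {set I})
    (D : complex T) :
  encodes_pairs V -> bipartite_complex V p q Z U D -> pure D ->
  (exists2 S, faces D S & #|` S| = (p + q)%N) ->
  (p <= #|Z :&: U|)%N -> (p + q <= #|U|)%N.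
Proof.
move=> eV bD pD [S DS cS] /subset_of_card[A].
rewrite subsetI => /andP[AZ AU] cA.
rewrite leqNgt; apply/negP=> ltU.
have [Vs Vc] := eV; have [fD DV] := bD.
have cUA : #|U :\: A| = (#|U| - p)%N by rewrite cardsD (setIidPr AU) cA.
have DUA : faces D (V A (U :\: A)).
  apply/fD; split=> //; rewrite ?subDset ?subsetUr ?cA //; last by lia.
  by rewrite -setI_eq0 setIDA setIC -setIDA setDv setI0.
(* No face has more than [p + q] elements, so one of that size is maximal. *)
have facetS : complex_facet D S.
  split=> // G DG SG; apply/esym/eqP; rewrite eqEfcard SG cS.
  exact: bipartite_face_card eV bD DG.
have facetUA : complex_facet D (V A (U :\: A)).
  split=> // G DG; have [A' [B' defG]] := DV G DG; rewrite defG in DG *.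
  move/fD: DG => [_ B'U dAB leA' _]; rewrite Vs => /andP[AA' UAB'].
  (* [A] already has the largest size [p], so a larger face can only grow in its second part, and
     that part already exhausts [U] outside [A]. *)
  have defA' : A' = A by apply/esym/eqP; rewrite eqEcard AA' cA.
  rewrite {}defA' in dAB *; congr (V A _); apply/eqP.
  by rewrite eqEsubset UAB' subsetD B'U disjoint_sym dAB.
have := pD _ _ facetS facetUA; rewrite cS Vc cA cUA.
have := subset_leq_card AU; lia.
Qed.

(** Deleting a vertex of the first part only forbids one column there, so the class of bipartite
    complexes is closed under shedding. *)
Lemma antistar_bipartite (I : finType) (T : choiceType)
    (V : {set I} -> {set I} -> {fset T}) (p q : nat) (Z U : {set I})
    (D : complex T) (j : I) :
  encodes_pairs V -> bipartite_complex V p q Z U D ->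
  bipartite_complex V p q (Z :\ j) U (antistar D (V [set j] set0)).
Proof.
move=> [Vs _] [fD DV]; split=> [A B|S [/DV//]].
rewrite /= Vs sub0set andbT sub1set subsetD1.
split=> [[/fD[AZ BU dAB leA leB] ->]|[/andP[AZ jA] *]]; first by rewrite AZ.
by split=> //; apply/fD.
Qed.

(** The inequality on [#|Z| + #|U|] is the induction invariant: at most three of the [2 * #|I|]
    vertices are gone. Purity improves three to two, at most one on each side, which pays for the
    next shedding. *)
Lemma bipartite_not_weakly_vertex_decomposable (I : finType) (T : choiceType)
    (V : {set I} -> {set I} -> {fset T}) (p q : nat) (Z U : {set I})
    (D : complex T) :
  encodes_pairs V -> (1 < p)%N -> (1 < q)%N -> #|I| = (p + q).+1 ->
  bipartite_complex V p q Z U D -> (2 * #|I| <= #|Z| + #|U| + 3)%N ->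
  (exists2 S, faces D S & #|` S| = (p + q)%N) ->
  ~ weakly_vertex_decomposable D.
Proof.
move=> eV p1 q1 cI bD leZU fullD wD.
elim: wD Z U bD leZU fullD => {D} [D r _ _ _ [W _ DW] Z U bD leZU _|].
  have [Vs _] := eV; have [fD DV] := bD.
  have cUI := cardsUI Z U; have cU : (#|Z :|: U| <= #|I|)%N := max_card _.
  have /set0Pn[j] : Z :&: U != set0 by rewrite -card_gt0; lia.
  rewrite inE => /andP[jZ jU].
  (* Both vertices of column [j] belong to the simplex, hence to its top face [W], whose two parts
     must be disjoint. *)
  have DWW : faces D W by apply/DW.
  have [A [B defW]] := DV W DWW.
  have /DW : faces D (V [set j] set0).
    apply/fD; rewrite sub1set jZ sub0set cards1 cards0 -setI_eq0 setI0.
    by split=> //; lia.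
  have /DW : faces D (V set0 [set j]).
    apply/fD; rewrite sub1set jU sub0set cards1 cards0 -setI_eq0 set0I.
    by split=> //; lia.
  rewrite defW !Vs !sub1set => /andP[_ jB] /andP[jA _].
  move: DWW; rewrite defW => /fD[_ _ /pred0P/(_ j)].
  by rewrite /= jA jB.
move=> D r tau [_ maxD] _ pD Dtau tau1 dimD' _ IH Z U bD leZU fullD.
have [Vs Vc] := eV; have [fD DV] := bD.
have cUI := cardsUI Z U; have cU : (#|Z :|: U| <= #|I|)%N := max_card _.
have leU : (p + q <= #|U|)%N.
  by apply: bipartite_pure_card eV bD pD fullD _; lia.
have leZ : (q + p <= #|Z|)%N.
  apply: bipartite_pure_card (encodes_pairs_swap eV)
    (bipartite_complex_swap bD) pD _ _.
    by rewrite addnC.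
  by rewrite setIC; lia.
(* Shedding preserves the dimension [r], and the full-size face of [D] shows that [r.+1 = p + q]. *)
have fullD' : exists2 S, faces (antistar D tau) S & #|` S| = (p + q)%N.
  have [[S D'S cS] _] := dimD'; exists S => //.
  have [S' DS' cS'] := fullD; apply/eqP.
  rewrite eqn_leq -{2}cS' cS maxD // andbT -cS.
  by case: D'S => DS _; apply: bipartite_face_card eV bD DS.
have [A [B deftau]] := DV tau Dtau.
rewrite {}deftau Vc in tau1 dimD' IH fullD' *.
(* [tau] has at most one element: a vertex of the first part, the empty face, or a vertex of the
   second part. *)
have [/eqP A0|] := eqVneq #|A| 0%N; last first.
  move=> A0; have /eqP/cards1P[j defA] : #|A| = 1%N by lia.
  have B0 : B = set0 by apply/eqP; rewrite -cards_eq0; lia.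
  rewrite defA B0 in fullD' IH *.
  apply: IH (antistar_bipartite j eV bD) _ fullD'.
  rewrite (cardsD1 j Z) in leZ *; have := leq_b1 (j \in Z); lia.
rewrite cards_eq0 in A0; rewrite {A0}(eqP A0) cards0 in tau1 fullD' IH *.
have [/eqP B0|B0] := eqVneq #|B| 0%N.
  (* The empty face lies in every face, so its antistar has no face at all. *)
  have [S [DS]] := fullD'; have [A' [B' ->]] := DV S DS.
  by rewrite cards_eq0 in B0; rewrite Vs (eqP B0) !sub0set.
have /eqP/cards1P[j defB] : #|B| = 1%N by lia.
rewrite defB in fullD' IH *.
have bD' := antistar_bipartite j (encodes_pairs_swap eV)
  (bipartite_complex_swap bD).
apply: IH (bipartite_complex_swap bD') _ fullD'.
rewrite (cardsD1 j U) in leU *; have := leq_b1 (j \in U); lia.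
Qed.

End ShedVertices.

(** * Affine dimension of sets and faces *)

Section AffineDimension.
Set Implicit Arguments.
Unset Strict Implicit.
Local Open Scope classical_set_scope.

(** Each [w] in [L] is a multiple of a difference [x - x0] with [x] in [A], so every subspace
    containing these differences contains [L]. *)
Lemma affdim_interior (R : realType) (V : vectType R) (A : set V) (x0 : V)
    (L : {vspace V}) :
  A x0 -> (forall x, A x -> x - x0 \in L) ->
  (forall w, w \in L -> exists2 e : R, e != 0 & A (x0 + e *: w)) ->
  has_affdim A (\dim L).
Proof.
move=> Ax0 AL LA; exists x0, L; split=> // W AW.
apply/subvP=> w /LA[e e0 /AW]; rewrite addrAC subrr add0r => ewW.
by rewrite -[w](scalerK e0) memvZ.
Qed.

(** Compares direction spaces taken at different base points: [x - x0] is a difference of two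
    vectors based at [x1]. *)
Lemma affdim_direction_sub (R : realType) (V : vectType R) (A B : set V)
    (x0 x1 : V) (U W : {vspace V}) :
  A `<=` B -> A x0 ->
  (forall W' : {vspace V}, (forall x, A x -> x - x0 \in W') -> (U <= W')%VS) ->
  (forall x, B x -> x - x1 \in W) -> (U <= W)%VS.
Proof.
move=> AB Ax0 minU BW; apply: minU => x Ax.
have -> : x - x0 = (x - x1) - (x0 - x1) by rewrite opprB addrA subrK.
by rewrite memvB ?BW//; apply: AB.
Qed.

Lemma affdim_uniq (R : realType) (V : vectType R) (A : set V) (r s : nat) :
  has_affdim A r -> has_affdim A s -> r = s.
Proof.
move=> [x [U [Ax AU minU <-]]] [y [W [Ay AW minW <-]]].
apply/eqP; rewrite eqn_leq; apply/andP; split; apply: dimvS.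
  exact: affdim_direction_sub (fun _ => id) Ax minU AW.
exact: affdim_direction_sub (fun _ => id) Ay minW AU.
Qed.

(* A face is cut out of [P] by its own affine hull. *)
Lemma face_eq_of_affdim (R : realType) (V : vectType R) (P F G : set V)
    (r : nat) :
  is_face P F -> F `<=` G -> G `<=` P -> has_affdim F r -> has_affdim G r ->
  F = G.
Proof.
move=> [c [delta [_ defF]]] FG GP [x [U [Fx FU minU dimU]]].
move=> [y [W [Gy GW minW dimW]]].
have /eqP defU : U == W.
  by rewrite eqEdim dimU dimW leqnn andbT;
    apply: (affdim_direction_sub FG Fx minU GW).
pose c' : {linear V -> R^o} := c.
have Uc : (U <= lker (linfun c'))%VS.
  apply: minU => z; move: Fx; rewrite defF => -[_ cx] [_ cz].
  by rewrite memv_ker lfunE /= linearB /= cx cz subrr.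
apply/seteqP; split=> // z Gz; rewrite defF; split; first exact: GP.
have : z - x \in U.
  have -> : z - x = (z - y) - (x - y) by rewrite opprB addrA subrK.
  by rewrite defU memvB ?GW//; apply: FG.
move/(subvP Uc); rewrite memv_ker lfunE /= linearB /= subr_eq0 => /eqP ->.
by move: Fx; rewrite defF => -[].
Qed.

End AffineDimension.

(** * Facets of general transportation polytopes *)

Section TransportationFacets.
Set Implicit Arguments.
Unset Strict Implicit.
Local Open Scope classical_set_scope.

(** The directions that change no margin; multiplying by all-ones vectors takes column and row sums,
    so this is an intersection of kernels. *)
Definition margin_space (R : realType) (p n : nat) : {vspace 'M[R]_(p, n)} :=
  (lker (linfun (mulmx (const_mx 1 : 'rV[R]_p))) :&:
   lker (linfun (mulmxr (const_mx 1 : 'cV[R]_n))))%VS.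

Lemma margin_spaceP (R : realType) (p n : nat) (W : 'M[R]_(p, n)) :
  reflect ((forall j, \sum_i W i j = 0) /\ (forall i, \sum_j W i j = 0))
          (W \in margin_space R p n).
Proof.
rewrite memv_cap !memv_ker !lfunE /=; apply: (iffP andP).
  move=> [/eqP/matrixP c0 /eqP/matrixP r0]; split=> [j|i].
    move: (c0 0 j); rewrite !mxE => cj; rewrite -[RHS]cj.
    by apply: eq_bigr => i _; rewrite mxE mul1r.
  move: (r0 i 0); rewrite !mxE => ri; rewrite -[RHS]ri.
  by apply: eq_bigr => j _; rewrite mxE mulr1.
move=> [c0 r0]; split; apply/eqP/matrixP=> i j; rewrite !mxE.
  by rewrite -[RHS](c0 j); apply: eq_bigr => k _; rewrite mxE mul1r.
by rewrite -[RHS](r0 i); apply: eq_bigr => k _; rewrite mxE mulr1.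
Qed.

(** The codomain is [R^o] so that the coordinate is a linear map between vector spaces and has a
    kernel in [{vspace _}]. *)
Definition entry (R : realType) (p n : nat) (i : 'I_p) (j : 'I_n)
  (X : 'M[R]_(p, n)) : R^o := X i j.

Fact entry_is_linear (R : realType) (p n : nat) (i : 'I_p) (j : 'I_n) :
  linear (@entry R p n i j).
Proof. by move=> k X Y; rewrite /entry !mxE. Qed.

HB.instance Definition _ (R : realType) (p n : nat) (i : 'I_p) (j : 'I_n) :=
  GRing.isLinear.Build R 'M[R]_(p, n) R^o *:%R (@entry R p n i j)
    (entry_is_linear i j).

Lemma transportation_shift (R : realType) (p n : nat) (a : 'rV[R]_p)
    (b : 'rV[R]_n) (X W : 'M[R]_(p, n)) (e : R) :
  transportation a b X -> W \in margin_space R p n ->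
  (forall i j, 0 <= (X + e *: W) i j) -> transportation a b (X + e *: W).
Proof.
move=> [_ Xb Xa] /margin_spaceP[Wb Wa] ge0; split=> // [j|i].
  under eq_bigr do rewrite !mxE.
  by rewrite big_split /= Xb -mulr_sumr Wb mulr0 addr0.
under eq_bigr do rewrite !mxE.
by rewrite big_split /= Xa -mulr_sumr Wa mulr0 addr0.
Qed.

Lemma transportation_diff (R : realType) (p n : nat) (a : 'rV[R]_p)
    (b : 'rV[R]_n) (X Y : 'M[R]_(p, n)) :
  transportation a b X -> transportation a b Y -> X - Y \in margin_space R p n.
Proof.
move=> [_ Xb Xa] [_ Yb Ya]; apply/margin_spaceP; split=> [j|i].
  by under eq_bigr do rewrite !mxE; rewrite sumrB Xb Yb subrr.
by under eq_bigr do rewrite !mxE; rewrite sumrB Xa Ya subrr.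
Qed.

Lemma nonneg_perturbation (R : realType) (p n : nat) (X W : 'M[R]_(p, n)) :
  (forall i j, 0 <= X i j) -> (forall i j, X i j = 0 -> W i j = 0) ->
  exists2 e : R, 0 < e & forall i j, 0 <= (X + e *: W) i j.
Proof.
move=> X0 XW; pose f (k : 'I_p * 'I_n) := X k.1 k.2 / (`|W k.1 k.2| + 1).
(* Only positive entries of [X] restrict the step; the default 1 covers the case of none, and the
   [+ 1] in [f] keeps the denominators positive. *)
pose e : R := \big[Num.min/1]_(k | 0 < X k.1 k.2) f k.
have Wgt0 i j : 0 < `|W i j| + 1 by rewrite ltr_wpDl.
have e0 : 0 < e by apply: lt_bigmin => // k Xk; rewrite divr_gt0.
exists e => // i j; rewrite !mxE.
have [/eqP Xij|Xij] := boolP (X i j == 0).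
  by rewrite Xij XW // mulr0 addr0.
have Xij0 : 0 < X i j by rewrite lt_def Xij X0.
have : e <= f (i, j) by apply: bigmin_le_cond.
rewrite /f /= ler_pdivlMr // => le_e.
have : - (e * W i j) <= e * `|W i j|.
  by rewrite -mulrN (ler_wpM2l (ltW e0)) // -normrN ler_norm.
by move: le_e e0; rewrite mulrDr mulr1; lra.
Qed.

Definition zero_face (R : realType) (p n : nat) (a : 'rV[R]_p) (b : 'rV[R]_n)
    (i : 'I_p) (j : 'I_n) : set 'M[R]_(p, n) :=
  [set X | transportation a b X /\ X i j = 0].

Lemma zero_face_is_face (R : realType) (p n : nat) (a : 'rV[R]_p)
    (b : 'rV[R]_n) (i : 'I_p) (j : 'I_n) :
  is_face (transportation a b) (zero_face a b i j).
Proof.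
(* The sign turns the minimum 0 of the entry into the maximum that [is_face] asks for. *)
exists (\- @entry R p n i j), 0; split=> [X [X0 _ _]|].
  by rewrite /= oppr_le0 X0.
apply/seteqP; split=> X [PX Xij]; split=> //.
  by rewrite /= /entry Xij oppr0.
by apply/eqP; rewrite -oppr_eq0; apply/eqP.
Qed.

(** Rank-nullity on [L]: the image of a functional nonzero at [w] has dimension 1. *)
Lemma dim_hyperplane (R : realType) (V : vectType R) (L : {vspace V})
    (f : 'Hom(V, R^o)) (w : V) :
  w \in L -> f w != 0 -> \dim L = (\dim (L :&: lker f)).+1.
Proof.
move=> wL fw; rewrite -(limg_ker_dim f L) -addn1; congr (_ + _)%N.
apply/eqP; rewrite eqn_leq; apply/andP; split.
  by rewrite (leq_trans (dimvS (subvf _))) // dimvf.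
rewrite lt0n dimv_eq0; apply: contraNneq fw => fL.
by rewrite -memv0 -fL memv_img.
Qed.

Lemma transportation_affdim (R : realType) (p n : nat) (a : 'rV[R]_p)
    (b : 'rV[R]_n) (X : 'M[R]_(p, n)) :
  transportation a b X -> (forall i j, X i j != 0) ->
  has_affdim (transportation a b) (\dim (margin_space R p n)).
Proof.
move=> PX X0; apply: (affdim_interior PX) => [Y PY|W LW].
  exact: transportation_diff PY PX.
have [|i j /eqP|e e0 ge0] := @nonneg_perturbation R p n X W.
- by case: PX.
- by rewrite (negPf (X0 i j)).
by exists e; rewrite ?gt_eqF //; apply: transportation_shift.
Qed.

(** A point whose only zero is at [(i, j)] can move a little in every margin-preserving direction
    that fixes this entry. *)
Lemma zero_face_affdim (R : realType) (p n : nat) (a : 'rV[R]_p)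
    (b : 'rV[R]_n) (i : 'I_p) (j : 'I_n) (X : 'M[R]_(p, n)) :
  transportation a b X ->
  (forall i' j', (X i' j' == 0) = ((i', j') == (i, j))) ->
  has_affdim (zero_face a b i j)
    (\dim (margin_space R p n :&: lker (linfun (@entry R p n i j)))).
Proof.
move=> PX X0; have Xij : X i j = 0 by apply/eqP; rewrite X0.
apply: (@affdim_interior _ _ _ X) => // [Y [PY Yij]|W].
  rewrite memv_cap (transportation_diff PY PX) memv_ker lfunE /= /entry.
  by rewrite !mxE Yij Xij subrr.
rewrite memv_cap memv_ker lfunE => /andP[LW /eqP Wij].
have [|i' j' /eqP|e e0 ge0] := @nonneg_perturbation R p n X W.
- by case: PX.
- by rewrite X0 => /eqP[-> ->].
exists e; rewrite ?gt_eqF //; split; first exact: transportation_shift.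
by rewrite !mxE Xij [W i j]Wij mulr0 addr0.
Qed.

Lemma zero_face_facet (R : realType) (p n : nat) (a : 'rV[R]_p)
    (b : 'rV[R]_n) (i : 'I_p) (j : 'I_n) (X Y : 'M[R]_(p, n)) :
  transportation a b X -> (forall i' j', X i' j' != 0) ->
  transportation a b Y ->
  (forall i' j', (Y i' j' == 0) = ((i', j') == (i, j))) ->
  is_facet (transportation a b) (zero_face a b i j).
Proof.
move=> PX X0 PY Y0; split; first exact: zero_face_is_face.
exists (\dim (margin_space R p n :&: lker (linfun (@entry R p n i j))));
  last first.
  exact: zero_face_affdim PY Y0.
(* [X - Y] preserves the margins but is nonzero at [(i, j)], so fixing that entry costs exactly one
   dimension. *)
rewrite -(@dim_hyperplane _ _ _ _ (X - Y)).
- exact: transportation_affdim PX X0.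
- exact: transportation_diff PX PY.
rewrite lfunE /= /entry !mxE.
by have /eqP -> : Y i j == 0; rewrite ?Y0 // subr0.
Qed.

(* If no entry vanished identically on the face [F], the average of points of
   [F] where the individual entries are positive would be a relative interior
   point of the polytope, forcing [F] to be the whole polytope. *)
Lemma facet_sub_zero_face (R : realType) (p n : nat) (a : 'rV[R]_p)
    (b : 'rV[R]_n) (F : set 'M[R]_(p, n)) :
  is_facet (transportation a b) F ->
  exists i j, F `<=` zero_face a b i j.
Proof.
move=> [[c [delta [cP defF]]] [r dimP dimF]]; apply: contrapT => noF.
have FX (k : 'I_p * 'I_n) : exists X, F X /\ 0 < X k.1 k.2.
  apply: contrapT => noX; apply: noF; exists k.1, k.2 => X FX.
  move: (FX); rewrite defF => -[PX _]; split=> //.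
  apply/eqP; apply: contra_notT noX => Xk; exists X; split=> //.
  by rewrite lt_def Xk; case: PX => ->.
have {FX} [f Ff] := choice FX.
have [x0 [_ [Fx0 _ _ _]]] := dimF.
(* One point per entry, plus [x0], which makes the average meaningful even for a matrix without
   entries. *)
pose N : R := (#|{: 'I_p * 'I_n}|.+1)%:R.
have N0 : N != 0 by rewrite pnatr_eq0.
pose X := N^-1 *: (x0 + \sum_k f k).
have PF Z : F Z -> transportation a b Z /\ c Z = delta by rewrite defF.
have Fge0 Z i j : F Z -> 0 <= Z i j by case/PF => -[].
have cX : c X = delta.
  rewrite linearZ linearD linear_sum /= (PF _ Fx0).2.
  under eq_bigr do rewrite (PF _ (Ff _).1).2.
  rewrite sumr_const -mulrS.
  by rewrite -mulr_natl mulKf.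
have Xgt0 i j : 0 < X i j.
  rewrite !mxE mulr_gt0 ?invr_gt0 ?ltr0n // ltr_wpDl ?Fge0 // summxE.
  rewrite (bigD1 (i, j)) //= ltr_pwDl ?(Ff (i, j)).2 // sumr_ge0 // => k _.
  by apply: Fge0; apply: (Ff k).1.
have PX : transportation a b X.
  have avg d : N^-1 * (d + \sum_(k : 'I_p * 'I_n) d) = d.
    by rewrite sumr_const -mulrS -mulr_natl mulKf.
  split=> [i j|j|i]; first exact: ltW.
    under eq_bigr do rewrite !mxE.
    rewrite -mulr_sumr big_split /=; case: (PF _ Fx0) => -[_ -> _] _.
    under [X in _ + X]eq_bigr do rewrite summxE.
    rewrite exchange_big /= -[RHS]avg; congr (_ * (_ + _));
      apply: eq_bigr => k _.
    by case: (PF _ (Ff k).1) => -[_ -> _].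
  under eq_bigr do rewrite !mxE.
  rewrite -mulr_sumr big_split /=; case: (PF _ Fx0) => -[_ _ ->] _.
  under [X in _ + X]eq_bigr do rewrite summxE.
  rewrite exchange_big /= -[RHS]avg; congr (_ * (_ + _));
      apply: eq_bigr => k _.
  by case: (PF _ (Ff k).1) => -[_ _ ->].
clearbody X.
have FP : F = transportation a b.
  apply/seteqP; split=> [Z /PF[]//|Y PY]; rewrite defF; split=> //.
  (* Moving from [X] away from [Y] stays in the polytope; as [c] is already maximal at [X], this
     forces [c Y] to be at least [delta]. *)
  have [i j|i j Xij|e e0 ge0] := @nonneg_perturbation R p n X (X - Y).
  - exact: ltW.
  - by have := Xgt0 i j; rewrite Xij ltxx.
  have := cP _ (transportation_shift PX (transportation_diff PX PY) ge0).
  rewrite linearD linearZ linearB /= cX gerDl pmulr_rle0 // subr_le0 => le_d.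
  by apply/le_anti; rewrite le_d cP.
by rewrite FP in dimF; case: (n_Sn r); apply: affdim_uniq dimF dimP.
Qed.

(** A facet lies in some zero face, which has the same dimension, and a face is determined by its
    affine hull. *)
Lemma facet_zero_face (R : realType) (p n : nat) (a : 'rV[R]_p)
    (b : 'rV[R]_n) (F : set 'M[R]_(p, n)) :
  (forall i j, is_facet (transportation a b) (zero_face a b i j)) ->
  is_facet (transportation a b) F -> exists i j, F = zero_face a b i j.
Proof.
move=> zf fF; have [i [j Fij]] := facet_sub_zero_face fF; exists i, j.
have [faceF [r dimP dimF]] := fF; have [_ [s dimP' dimG]] := zf i j.
have [eq_rs] := affdim_uniq dimP dimP'; rewrite -eq_rs in dimG.
by apply: face_eq_of_affdim faceF Fij _ dimF dimG => X [].
Qed.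

End TransportationFacets.

(** * The two-row polytope with column sums 2 and odd row sums *)

Section TwoRows.
Set Implicit Arguments.
Unset Strict Implicit.
Import mathcomp.boot.fintype mathcomp.boot.finset.

Definition zero_faces (R : realType) (n : nat) (a : 'rV[R]_2) (b : 'rV[R]_n)
    (A B : {set 'I_n}) : {fset set 'M[R]_(2, n)} :=
  ([fset zero_face a b 0 j | j in A] `|`
   [fset zero_face a b 1 j | j in B])%fset.

Lemma card_notin (n : nat) (A : {set 'I_n}) :
  (#|A| + #|[pred j | j \notin A]|)%N = n.
Proof. by rewrite -[RHS]card_ord -(cardC (mem A)). Qed.

Lemma ord2_cases (i : 'I_2) : i = 0 \/ i = 1.
Proof. by case: i => -[|[|//]] i2; [left|right]; apply: val_inj. Qed.

(** The row sum [k] is carried by the [n - #|A|] entries outside [A], each at most 2. *)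
Lemma row_zeros_card (R : realType) (n : nat) (A : {set 'I_n}) (x : 'I_n -> R)
    (k : nat) :
  (forall j, x j <= 2) -> (forall j, j \in A -> x j = 0) ->
  \sum_j x j = k%:R -> (2 * #|A| + k <= 2 * n)%N.
Proof.
move=> x2 xA xk; rewrite -(ler_nat R) natrD !natrM -xk (bigID (mem A)) /=.
rewrite big1 // add0r.
have : \sum_(j | j \notin A) x j <= \sum_(j | j \notin A) 2 by apply: ler_sum.
rewrite sumr_const -(mulr_natr 2).
have -> : #|[pred j | j \notin A]| = (n - #|A|)%N.
  by rewrite -[X in (X - _)%N](card_notin A) addKn.
have leA : (#|A| <= n)%N by rewrite -[X in (_ <= X)%N](card_notin A) leq_addr.
by rewrite natrB //; lra.
Qed.

(* Witness: entries forced by [A] and [B], all other columns equal. *)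
Lemma transportation_point (R : realType) (n k : nat) (a : 'rV[R]_2)
    (A B : {set 'I_n}) :
  a 0 0 = k%:R -> a 0 1 = (2 * n - k)%N%:R ->
  [disjoint A & B] -> (2 * #|A| + k < 2 * n)%N -> (2 * #|B| < k)%N ->
  exists2 X : 'M[R]_(2, n), transportation a (const_mx 2) X &
    forall j, ((X 0 j == 0) = (j \in A)) /\ ((X 1 j == 0) = (j \in B)).
Proof.
move=> a0 a1 dAB ltA ltB.
have cAB : #|A :|: B|%SET = (#|A| + #|B|)%N.
  by apply/eqP; rewrite (leq_card_setU A B).2.
pose r := (n - (#|A| + #|B|))%N.
have leAB : (#|A| + #|B| < n)%N by lia.
have r0 : (0 : R) < r%:R by rewrite ltr0n subn_gt0.
(* Columns of [B] contribute 2 each to the first row sum [k], and the [r] free columns share the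
   rest. The bounds on [#|B|] and [#|A|] give [0 < u] and [u < 2], so free columns have no zero. *)
pose u : R := (k - 2 * #|B|)%N%:R / r%:R.
have u0 : 0 < u by rewrite divr_gt0 // ltr0n subn_gt0.
have u2 : u < 2.
  by rewrite ltr_pdivrMr // -natrM ltr_nat /r; lia.
pose x j : R := if j \in A then 0 else if j \in B then 2 else u.
have sx : \sum_j x j = k%:R.
  rewrite (bigID (mem A)) /= big1 => [|j jA]; last by rewrite /x jA.
  rewrite add0r (bigID (mem B)) /=.
  rewrite (eq_bigr (fun _ => 2)); last first.
    by move=> j /andP[/negPf jA jB]; rewrite /x jA jB.
  rewrite [X in _ + X](eq_bigr (fun _ => u)); last first.
    by move=> j /andP[/negPf jA /negPf jB]; rewrite /x jA jB.
  rewrite !sumr_const.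
  have -> : #|[pred j | j \notin A & j \in B]| = #|B|.
    apply: eq_card => j; rewrite !inE andb_idl // => jB.
    by rewrite (disjointFl dAB).
  have -> : #|[pred j | j \notin A & j \notin B]| = r.
    rewrite /r -cAB -[X in (X - _)%N](card_notin (A :|: B)%SET) addKn.
    by apply: eq_card => j; rewrite !inE negb_or.
  rewrite -(mulr_natr u) divfK ?gt_eqF // -(mulr_natr 2) -natrM -natrD;
    congr _%:R; lia.
exists (\matrix_(i < 2, j < n) (if i == 0 then x j else 2 - x j)).
  have x02 j : 0 <= x j <= 2.
    by rewrite /x; case: ifP => _; [|case: ifP => _];
      rewrite ?lexx ?ler0n // !ltW.
  split=> [i j|j|i].
  - by rewrite mxE; case: ifP => _; rewrite ?subr_ge0; case/andP: (x02 j).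
  - by rewrite !big_ord_recl big_ord0 !mxE /= addr0 addrC subrK.
  under eq_bigr do rewrite mxE.
  have [->|->] := ord2_cases i; rewrite /= ?sx ?a0 ?a1 //.
  by rewrite sumrB sx sumr_const card_ord natrB ?natrM -?(mulr_natr 2) //; lia.
move=> j; rewrite !mxE /= /x; case: ifP => [jA|_].
  by rewrite eqxx subr0 pnatr_eq0 (disjointFr dAB).
case: ifP => _; first by rewrite subrr eqxx pnatr_eq0.
by rewrite subr_eq0 !gt_eqF.
Qed.

(** The first row runs over a slice of the cube of side 2. Since the row sums are odd, [#|A| <= p]
    and [#|B| <= q] already give the strict inequalities that an exact zero pattern requires. *)
Lemma cube_slice_point (R : realType) (n p q : nat) (a : 'rV[R]_2)
    (A B : {set 'I_n}) :
  n = (p + q).+1 -> a 0 0 = (2 * q).+1%:R -> a 0 1 = (2 * p).+1%:R ->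
  [disjoint A & B] -> (#|A| <= p)%N -> (#|B| <= q)%N ->
  exists2 X : 'M[R]_(2, n), transportation a (const_mx 2) X &
    forall j, ((X 0 j == 0) = (j \in A)) /\ ((X 1 j == 0) = (j \in B)).
Proof.
move=> np a0 a1 dAB leA leB.
by apply: (transportation_point a0) => //; [rewrite a1; congr _%:R|..]; lia.
Qed.

Lemma cube_slice_zero_entry (R : realType) (n p q : nat) (a : 'rV[R]_2)
    (i : 'I_2) (j : 'I_n) :
  n = (p + q).+1 -> (0 < p)%N -> (0 < q)%N ->
  a 0 0 = (2 * q).+1%:R -> a 0 1 = (2 * p).+1%:R ->
  exists2 X : 'M[R]_(2, n), transportation a (const_mx 2) X &
    forall i' j', (X i' j' == 0) = ((i', j') == (i, j)).
Proof.
move=> np p0 q0 a0 a1; have [->|->] := ord2_cases i.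
  have [|||X PX X0] := cube_slice_point (A := [set j]%SET) (B := set0) np a0 a1.
  - by rewrite disjoint_sym disjoints_subset sub0set.
  - by rewrite cards1.
  - by rewrite cards0.
  exists X => // i' j'; have [E0 E1] := X0 j'.
  by have [->|->] := ord2_cases i'; rewrite ?E0 ?E1 !inE xpair_eqE.
have [|||X PX X0] := cube_slice_point (A := set0) (B := [set j]%SET) np a0 a1.
- by rewrite disjoints_subset sub0set.
- by rewrite cards0.
- by rewrite cards1.
exists X => // i' j'; have [E0 E1] := X0 j'.
by have [->|->] := ord2_cases i'; rewrite ?E0 ?E1 !inE xpair_eqE.
Qed.

Lemma cube_slice_facet (R : realType) (n p q : nat) (a : 'rV[R]_2)
    (i : 'I_2) (j : 'I_n) :
  n = (p + q).+1 -> (0 < p)%N -> (0 < q)%N ->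
  a 0 0 = (2 * q).+1%:R -> a 0 1 = (2 * p).+1%:R ->
  is_facet (transportation a (const_mx 2)) (zero_face a (const_mx 2) i j).
Proof.
move=> np p0 q0 a0 a1.
have [Y PY Y0] := cube_slice_zero_entry i j np p0 q0 a0 a1.
have [|||X PX X0] := cube_slice_point (A := set0) (B := set0) np a0 a1.
- by rewrite disjoints_subset sub0set.
- by rewrite cards0.
- by rewrite cards0.
apply: zero_face_facet PX _ PY Y0 => i' j'; have [E0 E1] := X0 j'.
by have [->|->] := ord2_cases i'; rewrite ?E0 ?E1 inE.
Qed.

(** A point with a single zero entry lies on one zero face only. *)
Lemma zero_face_inj (R : realType) (n p q : nat) (a : 'rV[R]_2)
    (i i' : 'I_2) (j j' : 'I_n) :
  n = (p + q).+1 -> (0 < p)%N -> (0 < q)%N ->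
  a 0 0 = (2 * q).+1%:R -> a 0 1 = (2 * p).+1%:R ->
  zero_face a (const_mx 2) i j = zero_face a (const_mx 2) i' j' ->
  (i, j) = (i', j').
Proof.
move=> np p0 q0 a0 a1 eq_zf.
have [X PX X0] := cube_slice_zero_entry i j np p0 q0 a0 a1.
have : zero_face a (const_mx 2) i j X by split=> //; apply/eqP; rewrite X0.
by rewrite eq_zf => -[_ /eqP]; rewrite X0 => /eqP.
Qed.

Lemma zero_facesP (R : realType) (n : nat) (a : 'rV[R]_2) (b : 'rV[R]_n)
    (A B : {set 'I_n}) (F : set 'M[R]_(2, n)) :
  reflect ((exists2 j, j \in A & F = zero_face a b 0 j) \/
           (exists2 j, j \in B & F = zero_face a b 1 j))
          (F \in zero_faces a b A B).
Proof.
rewrite in_fsetU; apply: (iffP orP) => -[].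
- by move=> /imfsetP[j jA ->]; left; exists j.
- by move=> /imfsetP[j jB ->]; right; exists j.
- by move=> [j jA ->]; left; apply/imfsetP; exists j.
- by move=> [j jB ->]; right; apply/imfsetP; exists j.
Qed.

Lemma zero_faces_encodes (R : realType) (n p q : nat) (a : 'rV[R]_2) :
  n = (p + q).+1 -> (0 < p)%N -> (0 < q)%N ->
  a 0 0 = (2 * q).+1%:R -> a 0 1 = (2 * p).+1%:R ->
  encodes_pairs (@zero_faces R n a (const_mx 2)).
Proof.
move=> np p0 q0 a0 a1.
have inj i i' j j' := @zero_face_inj R n p q a i i' j j' np p0 q0 a0 a1.
split=> A B.
  move=> A' B'; apply/idP/andP.
    move=> /fsubsetP sV; split; apply/subsetP => j jX.
      have /sV/zero_facesP[[j' j'A /inj[->]//]|[j' _ /inj//]] :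
        zero_face a (const_mx 2) 0 j \in zero_faces a (const_mx 2) A B.
      by apply/zero_facesP; left; exists j.
    have /sV/zero_facesP[[j' _ /inj//]|[j' j'A /inj[->]//]] :
      zero_face a (const_mx 2) 1 j \in zero_faces a (const_mx 2) A B.
    by apply/zero_facesP; right; exists j.
  move=> [/subsetP AA' /subsetP BB'].
  apply/fsubsetP => F /zero_facesP[[j jA ->]|[j jB ->]]; apply/zero_facesP.
    by left; exists j => //; apply: AA'.
  by right; exists j => //; apply: BB'.
(* Zero faces of different rows are distinct, so the sizes of the two parts add up. *)
rewrite cardfsU [X in (_ - #|` X|)%N](_ : _ = fset0) ?cardfs0 ?subn0.
  by congr (_ + _)%N; rewrite card_imfset -?cardE //= => j j' /inj[].
apply/fsetP => F; rewrite in_fsetI in_fset0; apply/negbTE/andP.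
by move=> [/imfsetP[j _ ->] /imfsetP[j' _ /inj]].
Qed.

(** All facets are zero faces, so a face of the polar prescribes zeros at some common point;
    counting bounds such patterns, and the explicit points realise all those within the bounds. *)
Lemma polar_cube_slice (R : realType) (n p q : nat) (a : 'rV[R]_2) :
  n = (p + q).+1 -> (0 < p)%N -> (0 < q)%N ->
  a 0 0 = (2 * q).+1%:R -> a 0 1 = (2 * p).+1%:R ->
  bipartite_complex (@zero_faces R n a (const_mx 2)) p q [set: 'I_n]%SET
    [set: 'I_n]%SET (polar_complex (transportation a (const_mx 2 : 'rV[R]_n))).
Proof.
move=> np p0 q0 a0 a1.
have facet i (j : 'I_n) := cube_slice_facet i j np p0 q0 a0 a1.
split=> [A B|S [Sfacet _]]; last first.
  exists [set j | zero_face a (const_mx 2) 0 j \in S]%SET.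
  exists [set j | zero_face a (const_mx 2) 1 j \in S]%SET.
  apply/fsetP=> F; apply/idP/zero_facesP=> [SF|]; last first.
    by move=> [[j + ->]|[j + ->]]; rewrite inE.
  have [i [j defF]] := facet_zero_face facet (Sfacet F SF).
  have [i0|i1] := ord2_cases i; [left|right]; exists j; rewrite ?inE;
    by rewrite -?i0 -?i1 -?defF.
split=> [[_ [X [Xge0 Xcol Xrow] XV]]|[_ _ dAB leA leB]]; last first.
  split=> [F /zero_facesP[[j _ ->]|[j _ ->]]//|].
  have [X PX X0] := cube_slice_point np a0 a1 dAB leA leB.
  exists X => // F /zero_facesP[[j jA ->]|[j jB ->]]; split=> //; apply/eqP.
    by rewrite (X0 j).1.
  by rewrite (X0 j).2.
have XA j : j \in A -> X 0 j = 0.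
  move=> jA; suff [] : zero_face a (const_mx 2) 0 j X by [].
  by apply: XV; apply/zero_facesP; left; exists j.
have XB j : j \in B -> X 1 j = 0.
  move=> jB; suff [] : zero_face a (const_mx 2) 1 j X by [].
  by apply: XV; apply/zero_facesP; right; exists j.
have X2 j : X 0 j + X 1 j = 2.
  have := Xcol j; rewrite !big_ord_recl big_ord0 addr0 mxE => <-.
  by congr (X _ _ + X _ _); apply: val_inj.
split; rewrite ?subsetT //.
- rewrite -setI_eq0; apply/eqP/setP=> j; rewrite !inE.
  apply/negbTE/andP => -[/XA j0 /XB j1].
  by have /eqP := X2 j; rewrite j0 j1 addr0 eq_sym pnatr_eq0.
(* The count gives [2 * #|A| <= 2 * p + 1], hence [#|A| <= p] by parity; the second row is alike
   with [q]. *)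
- have := row_zeros_card _ XA; rewrite Xrow => /(_ _ _ a0).
  have X0le j : X 0 j <= 2 by rewrite -(X2 j) lerDl.
  by move=> /(_ X0le); lia.
have := row_zeros_card _ XB; rewrite Xrow => /(_ _ _ a1).
have X1le j : X 1 j <= 2 by rewrite -(X2 j) lerDr.
by move=> /(_ X1le); lia.
Qed.

End TwoRows.

(** * The margins [2m - 1] and [2m + 1] *)

Theorem theorem3p2 (R : realType) (m : nat) (hm : (3 <= m)%N) :
  ~ weakly_vertex_decomposable
      (polar_complex
         (transportation
            (\row_(i < 2) [:: (2 * m)%:R - 1; (2 * m)%:R + 1]`_i : 'rV[R]_2)
            (const_mx 2 : 'rV[R]_(2 * m)))).
Proof.
set a := (X in transportation X).
(* Take [p = m] and [q = m - 1], so that the row sums are [2q + 1] and [2p + 1]. The bound [1 < q]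
   below is exactly [3 <= m]. *)
have np : (2 * m = (m + m.-1).+1)%N by lia.
have p0 : (0 < m)%N by lia.
have q0 : (0 < m.-1)%N by lia.
have a0 : a 0 0 = (2 * m.-1).+1%:R.
  have -> : (2 * m.-1).+1 = (2 * m - 1)%N by lia.
  by rewrite mxE natrB //; lia.
have a1 : a 0 1 = (2 * m).+1%:R by rewrite mxE /= -natr1.
have eV := zero_faces_encodes np p0 q0 a0 a1.
have bD := polar_cube_slice np p0 q0 a0 a1.
apply: (bipartite_not_weakly_vertex_decomposable eV _ _ _ bD).
- by lia.
- by lia.
- by rewrite card_ord.
- by rewrite cardsT card_ord; lia.
have [_ Vc] := eV; have [fD _] := bD.
(* A full-size face: any [m] columns for [A], then any [m - 1] of the remaining [m] for [B]. *)
have [A _ cA] : exists2 A : {set 'I_(2 * m)},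
    A \subset [set: 'I_(2 * m)]%SET & #|A| = m.
  by apply: subset_of_card; rewrite cardsT card_ord; lia.
have [B BA cB] : exists2 B : {set 'I_(2 * m)}, B \subset ~: A & #|B| = m.-1.
  by apply: subset_of_card; rewrite finset.cardsCs
    finset.setCK card_ord cA; lia.
exists (zero_faces a (const_mx 2) A B); last by rewrite Vc cA cB.
apply/fD; rewrite !finset.subsetT cA cB; split=> //.
by rewrite disjoint_sym finset.disjoints_subset.
Qed.
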